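(* Let $K$ be any field and let $p$ be any positive integer. Then there exist a polynomial ring $R$ over $K$ (in finitely many variables) and an ideal $I\subseteq R$ with three homogeneous generators in degree $p^2$ such that $\operatorname{pd}(R/I)\ge p^{p-1}$.
   Context: Polynomial rings carry the standard grading (every variable has degree $1$). $\operatorname{pd}(R/I)$ denotes the projective dimension of $R/I$ as an $R$-module, i.e. the length of its minimal graded free resolution. *)

(* Defs.v *)
From HB Require Import structures.
From mathcomp Require Import all_boot all_order all_algebra.
From mathcomp Require Import boolp.
From mathcomp.multinomials Require Export mpoly.

Set Implicit Arguments.
Unset Strict Implicit.
Unset Printing Implicit Defensive.

Import GRing.Theory.
Local Open Scope ring_scope.
Local Open Scope quotient_scope.

Section GeneratedIdeal.
Variables (R : comNzRingType) (k : nat) (f : 'I_k -> R).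

Definition ideal_gen : {pred R} :=
  fun x => `[< exists c : 'I_k -> R, x = \sum_(i < k) c i * f i >].

Lemma ideal_genP (x : R) :
  reflect (exists c : 'I_k -> R, x = \sum_(i < k) c i * f i) (x \in ideal_gen).
Proof. exact: asboolP. Qed.

Lemma ideal_gen_zmod_closed : zmod_closed ideal_gen.
Proof.
split=> [|x y /ideal_genP[c ->] /ideal_genP[d ->]]; apply/ideal_genP.
  by exists (fun=> 0); rewrite big1 // => i _; rewrite mul0r.
exists (fun i => c i - d i); rewrite -sumrB.
by apply: eq_bigr => i _; rewrite mulrBl.
Qed.

HB.instance Definition _ :=
  GRing.isZmodClosed.Build R ideal_gen ideal_gen_zmod_closed.

Lemma ideal_genMl (a x : R) : x \in ideal_gen -> a * x \in ideal_gen.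
Proof.
move=> /ideal_genP[c ->]; apply/ideal_genP.
exists (fun i => a * c i); rewrite mulr_sumr.
by apply: eq_bigr => i _; rewrite mulrA.
Qed.

(* [{ideal_quot I}] is a ring and needs I to be a decidable proper ideal;
   here R / I is only wanted as an R-module, for an arbitrary I. *)
Definition quot_ideal : Type := Quotient.quot ideal_gen.

HB.instance Definition _ := GRing.Zmodule.on quot_ideal.

Definition quot_pi (x : R) : quot_ideal := \pi_(Quotient.quot ideal_gen) x.

Definition quot_scale (a : R) (q : quot_ideal) : quot_ideal :=
  quot_pi (a * repr q).

Lemma quot_piP (q : quot_ideal) : exists x, q = quot_pi x.
Proof. by exists (repr q); rewrite /quot_pi reprK. Qed.

Lemma quot_pi_eq (x y : R) : (quot_pi x == quot_pi y) = (x - y \in ideal_gen).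
Proof. by rewrite [RHS]Quotient.idealrBE. Qed.

Lemma quot_piD : {morph quot_pi : x y / x + y}.
Proof. by move=> x y; rewrite /quot_pi Quotient.pi_add. Qed.

Lemma quot_scale_pi (a x : R) : quot_scale a (quot_pi x) = quot_pi (a * x).
Proof.
apply/eqP; rewrite quot_pi_eq -mulrBr; apply: ideal_genMl.
by rewrite -quot_pi_eq /quot_pi reprK.
Qed.

Lemma quot_scaleA a b q : quot_scale a (quot_scale b q) = quot_scale (a * b) q.
Proof. by have [x ->] := quot_piP q; rewrite !quot_scale_pi mulrA. Qed.

Lemma quot_scale1 : left_id 1 quot_scale.
Proof. by move=> q; have [x ->] := quot_piP q; rewrite quot_scale_pi mul1r. Qed.

Lemma quot_scaleDr : right_distributive quot_scale +%R.
Proof.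
move=> a q r; have [x ->] := quot_piP q; have [y ->] := quot_piP r.
by rewrite -quot_piD !quot_scale_pi mulrDr quot_piD.
Qed.

Lemma quot_scaleDl q : {morph quot_scale^~ q : a b / a + b}.
Proof.
move=> a b; have [x ->] := quot_piP q.
by rewrite !quot_scale_pi mulrDl quot_piD.
Qed.

HB.instance Definition _ := GRing.Zmodule_isLmodule.Build R quot_ideal
  quot_scaleA quot_scale1 quot_scaleDr quot_scaleDl.

End GeneratedIdeal.

Definition projective_module (R : comNzRingType) (P : lmodType R) : Prop :=
  forall (A B : lmodType R) (g : {linear A -> B}) (u : {linear P -> B}),
    (forall b, exists a, g a = b) ->
    exists h : {linear P -> A}, forall x, g (h x) = u x.

(* ... -> P 2 -> P 1 -> P 0 -> M -> 0 is exact, with every P i projective. *)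
Definition projective_resolution (R : comNzRingType) (M : lmodType R)
    (P : nat -> lmodType R) (d : forall i, {linear P i.+1 -> P i})
    (aug : {linear P 0 -> M}) : Prop :=
  [/\ forall i, projective_module (P i),
      forall m, exists x, aug x = m,
      forall x, aug x = 0 <-> exists y, d 0 y = x
    & forall i x, d i x = 0 <-> exists y, d i.+1 y = x].

(* pd M <= l: some projective resolution of M vanishes in degrees > l. *)
Definition pd_le (R : comNzRingType) (M : lmodType R) (l : nat) : Prop :=
  exists (P : nat -> lmodType R) (d : forall i, {linear P i.+1 -> P i})
         (aug : {linear P 0 -> M}),
    projective_resolution d aug /\
    forall i, (l < i)%N -> forall x : P i, x = 0.

(* The infimum defining pd M is taken in nat extended by infinity, so this also
   holds when M has no finite projective resolution. *)
Definition pd_ge (R : comNzRingType) (M : lmodType R) (l : nat) : Prop :=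
  forall e : nat, pd_le M e -> (l <= e)%N.

Definition minimal_generators (R : comNzRingType) (k : nat)
    (f : 'I_k.+1 -> R) : Prop :=
  forall i, f i \notin ideal_gen (fun j : 'I_k => f (lift i j)).

(* Main.v *)
From HB Require Import structures.
From mathcomp.multinomials Require Import freeg.
Require Import Defs.
From mathcomp Require Import all_boot all_algebra.
From mathcomp Require Import boolp zify.

(**
  The lower bound on the projective dimension comes from depth.  If a nonzero
  element [s] of a module [M] is killed by a sequence [x_0, ..., x_(n-1)] that
  is regular on the ring, then [pd M >= n] ([pd_ge_regular]).  Given a
  projective resolution with syzygies [Z_0 = M, Z_1, Z_2, ...], one shows that
  [Z_k / (x_0, ..., x_(k-1)) Z_k] still contains a nonzero element killed by
  all the [x_j], for every [k <= n] ([socle_syzygy]): lift such an element of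
  [Z_k] to [p] in the projective module above it and correct [x_k p] by a
  combination of [x_0, ..., x_(k-1)] so that it falls in [Z_(k+1)].  Hence
  [Z_n] is nonzero, and the resolution has length at least [n].  The facts
  about Tor that this needs reduce to [ideal_mul_meet_kernel]: if the sequence
  is regular on the image of [d], then the ideal it generates meets the kernel
  of [d] only in the obvious elements.

  It remains to find three forms of degree [p^2] and a polynomial [s] outside
  their ideal [I] such that [s] is killed modulo [I] by [p^(p-1)] variables.
  Let [I] contain [c u^(D+1)], [c v^(D+1)] and [c] times a sum of terms
  [u^e v^(m-e) h_e], where [m <= D].  Multiplying that sum by
  [u^(D-e) v^(D-m+e)] pushes every other term into the ideal of the two
  powers, so [c u^D v^D h_e] is in [I] for every [e] ([ideal_gen_coeff]).  With
  [c = 1] this turns three generators into many.  To repeat the process, two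
  of the coefficients [h_e] are spent on the powers [u'^D'], [v'^D'] of two
  fresh variables, and each of the others is again a sum of the same shape, in
  [u'] and [v'].  Taking [m = p + 1] leaves [p] useful coefficients at each
  level and lowers the degree by [p + 1]; after [p - 1] levels the degree has
  gone from [p^2 = 1 + (p - 1)(p + 1)] to [1], and the coefficients are
  [p^(p-1)] distinct variables, all killed by the product [s] of the
  [u^D v^D] of all levels ([leaf_socle]).

  Finally [s] is not in [I], since every monomial of every generator is
  divisible by a variable at the bottom or by some [u^(D+1)] or [v^(D+1)],
  and no such monomial divides [s] ([socle_notin]).
*)

Set Implicit Arguments.
Unset Strict Implicit.
Unset Printing Implicit Defensive.

Import GRing.Theory.
Local Open Scope ring_scope.

(** * Regular sequences and projective dimension *)

Section RegularSequence.
Variables (R : comNzRingType) (x : nat -> R).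

(** The submodule [(x_0, ..., x_(k-1)) S].  Submodules are predicates on an
    ambient module because the syzygies are only ever compared inside the
    modules of the resolution that contain them. *)
Definition ideal_mul (Q : lmodType R) (k : nat) (S : Q -> Prop) (z : Q) :=
  exists c : nat -> Q, (forall i, S (c i)) /\ z = \sum_(i < k) x i *: c i.

(** Weak regularity: [S] may equal [(x_0, ..., x_(k-1)) S], as happens for
    the zero module. *)
Definition regular (Q : lmodType R) (k : nat) (S : Q -> Prop) :=
  forall l z, (l < k)%N -> S z -> ideal_mul l S (x l *: z) -> ideal_mul l S z.

Definition whole (Q : lmodType R) (z : Q) := True.

Definition kernel (Q Q' : lmodType R) (d : {linear Q' -> Q}) (z : Q') := d z = 0.

Definition image (Q Q' : lmodType R) (d : {linear Q' -> Q}) (z : Q) :=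
  exists y, d y = z.

Lemma ideal_mulD (Q : lmodType R) (S : Q -> Prop) k u v :
  (forall a b, S a -> S b -> S (a + b)) ->
  ideal_mul k S u -> ideal_mul k S v -> ideal_mul k S (u + v).
Proof.
move=> SD [a [Sa ->]] [b [Sb ->]].
exists (fun i => a i + b i); split=> [i|]; first exact: SD.
by rewrite -big_split; apply: eq_bigr => i _; rewrite scalerDr.
Qed.

Lemma kernelD (Q Q' : lmodType R) (d : {linear Q' -> Q}) u v :
  kernel d u -> kernel d v -> kernel d (u + v).
Proof. by rewrite /kernel raddfD /= => -> ->; rewrite addr0. Qed.

Lemma ideal_mul_term (Q : lmodType R) k (S : Q -> Prop) i z :
  (i < k)%N -> S 0 -> S z -> ideal_mul k S (x i *: z).
Proof.
move=> ik S0 Sz; exists (fun j => if j == i then z else 0); split=> [j|].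
  by case: eqP.
rewrite (bigD1 (Ordinal ik)) //= eqxx big1 ?addr0 // => j.
by rewrite -val_eqE /= => /negbTE ->; rewrite scaler0.
Qed.

Lemma ideal_mul_widen (Q : lmodType R) k (S : Q -> Prop) z :
  S 0 -> ideal_mul k S z -> ideal_mul k.+1 S z.
Proof.
move=> S0 [c [Sc ->]]; exists (fun i => if i == k then 0 else c i); split=> [i|].
  by case: eqP.
rewrite big_ord_recr /= eqxx scaler0 addr0; apply: eq_bigr => i _.
by rewrite ltn_eqF.
Qed.

Lemma image_lift (Q Q' : lmodType R) (d : {linear Q' -> Q}) k z :
  ideal_mul k (image d) z -> exists c : nat -> Q',
    z = d (\sum_(i < k) x i *: c i).
Proof.
move=> [b [/choice[c dc] ->]]; exists c; rewrite raddf_sum /=.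
by apply: eq_bigr => i _; rewrite linearZ /= dc.
Qed.

Lemma ideal_mul_image (Q Q' : lmodType R) (d : {linear Q' -> Q}) k (c : nat -> Q') :
  ideal_mul k (image d) (d (\sum_(i < k) x i *: c i)).
Proof.
exists (d \o c); split=> [i|]; first by exists (c i).
by rewrite raddf_sum /=; apply: eq_bigr => i _; rewrite linearZ.
Qed.

(** This is the vanishing of Tor_1 of the image of [d] with
    [R / (x_0, ..., x_(m-1))].  In a relation [sum x_i (d c_i) = 0], regularity
    writes [d c_m] as a combination of the [x_i], [i < m]; subtracting a lift
    of it replaces [c_m] by an element of the kernel and leaves a shorter
    relation. *)
Lemma ideal_mul_meet_kernel (Q Q' : lmodType R) (d : {linear Q' -> Q}) m
    (c : nat -> Q') :
  regular m (image d) -> d (\sum_(i < m) x i *: c i) = 0 ->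
  ideal_mul m (kernel d) (\sum_(i < m) x i *: c i).
Proof.
elim: m c => [|m IHm] c reg dc0.
  by exists (fun=> 0); split=> [i|]; [exact: raddf0 | rewrite !big_ord0].
have [b dcm] : exists b : nat -> Q', d (c m) = d (\sum_(i < m) x i *: b i).
  apply/image_lift/reg => //; first by exists (c m).
  have -> : x m *: d (c m) = d (\sum_(i < m) x i *: - c i).
    apply/eqP; rewrite -linearZ -subr_eq0 -raddfB -sumrN /=.
    under [X in _ + X]eq_bigr => i _ do rewrite scalerN opprK.
    by rewrite addrC; apply/eqP; move: dc0; rewrite big_ord_recr.
  exact: (ideal_mul_image d m (fun i => - c i)).
set q := c m - \sum_(i < m) x i *: b i.
have dq : kernel d q by rewrite /kernel raddfB /= dcm subrr.
pose c' i := c i + x m *: b i.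
have E : \sum_(i < m.+1) x i *: c i = \sum_(i < m) x i *: c' i + x m *: q.
  rewrite big_ord_recr /= /q scalerBr.
  under [in RHS]eq_bigr => i _ do rewrite scalerDr scalerA mulrC -scalerA.
  by rewrite big_split /= -scaler_sumr addrACA addrC subrr addr0 addrC.
rewrite E; apply: ideal_mulD; [exact: kernelD | | ]; last first.
  by apply: ideal_mul_term => //; exact: raddf0.
apply: ideal_mul_widen; first exact: raddf0.
apply: IHm; first by move=> l z lm; apply: reg; exact: ltnW.
by have := dc0; rewrite E raddfD /= linearZ /= [d q]dq scaler0 addr0.
Qed.

(** Each syzygy gains one step of regularity: an element of the kernel that is
    in [(x_0, ..., x_(l-1)) Q'] is in [(x_0, ..., x_(l-1))] times the kernel. *)
Lemma regular_kernel (Q Q' : lmodType R) (d : {linear Q' -> Q}) k :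
  regular k (image d) -> regular k.+1 (@whole Q') -> regular k.+1 (kernel d).
Proof.
move=> regI regQ l z lk dz [c [_ xz]].
have [|c' [_ zc']] := regQ l z lk I; first by exists c.
rewrite zc'; apply: ideal_mul_meet_kernel; last by rewrite -zc'.
by move=> i y il; apply: regI; exact: leq_trans il lk.
Qed.

(** The class of [w] in [S / (x_0, ..., x_(k-1)) S] is nonzero and killed by
    [x_0, ..., x_(n-1)]. *)
Definition socle_elt (Q : lmodType R) n k (S : Q -> Prop) (w : Q) :=
  [/\ S w, ~ ideal_mul k S w
    & forall j, (j < n)%N -> ideal_mul k S (x j *: w)].

(** The new element is [w = x_k p - sum_(i < k) x_i q_i], where [p] lifts [s]
    and the [q_i] are chosen so that [d w = 0].  If it were in
    [(x_0, ..., x_k)] times the kernel, regularity would cancel [x_k] and put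
    [s] in [(x_0, ..., x_(k-1))] times the image. *)
Lemma socle_syzygy (Q Q' : lmodType R) (d : {linear Q' -> Q}) n k s :
  (k < n)%N -> regular k (image d) -> regular k.+1 (@whole Q') ->
  socle_elt n k (image d) s -> exists w, socle_elt n k.+1 (kernel d) w.
Proof.
move=> kn regI regQ [[p <-{s}] sNI xs].
have dK0 : kernel d 0 by exact: raddf0.
have [q xkp] := image_lift (xs k kn); rewrite -linearZ /= in xkp.
pose w := x k *: p - \sum_(i < k) x i *: q i.
have dw : d w = 0 by rewrite raddfB /= xkp subrr.
exists w; split=> // [[c [dc wc]] | j jn].
  apply: sNI; have [|a [_ pa]] := regQ k (p - c k) (ltnSn k) I.
    exists (fun i => q i + c i); split=> //.
    rewrite scalerBr; apply/eqP; rewrite subr_eq.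
    move: wc => /eqP; rewrite subr_eq => /eqP ->.
    rewrite big_ord_recr /= addrAC -big_split /=; apply/eqP; congr (_ + _).
    by apply: eq_bigr => i _; rewrite scalerDr addrC.
  have -> : d p = d (\sum_(i < k) x i *: a i).
    by rewrite -pa raddfB /= [d (c k)]dc subr0.
  exact: ideal_mul_image.
(* [x_j p = sum x_i r_i + z] with [z] in the kernel, so [x_j w] is [x_k z]
   plus a combination of [x_0, ..., x_(k-1)] that lies in the kernel. *)
have [r xjp] := image_lift (xs j jn); rewrite -linearZ /= in xjp.
pose z := x j *: p - \sum_(i < k) x i *: r i.
have dz : kernel d z by rewrite /kernel raddfB /= xjp subrr.
pose u i := x k *: r i - x j *: q i.
have E : x j *: w = \sum_(i < k) x i *: u i + x k *: z.
  rewrite /w /z /u !scalerBr.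
  under [in RHS]eq_bigr => i _ do
    rewrite scalerBr !scalerA ![x i * _]mulrC -!scalerA.
  rewrite big_split /= sumrN -!scaler_sumr [RHS]addrC addrA subrK.
  by rewrite !scalerA mulrC.
rewrite E; apply: ideal_mulD; [exact: kernelD | | exact: ideal_mul_term].
apply/ideal_mul_widen/ideal_mul_meet_kernel => //.
have : d (x j *: w) = 0 by rewrite linearZ /= dw scaler0.
by rewrite E raddfD /= [d (x k *: z)]linearZ /= [d z]dz scaler0 addr0.
Qed.

Lemma fglift_is_scalable (K : choiceType) (M : lmodType R) (f : K -> M) :
  scalable (fglift f : {freeg K / R} -> M).
Proof.
pose F := GRing.isAdditive.Build {freeg K / R} M (fglift f) (lift_is_additive f).
pose G : {additive {freeg K / R} -> M} := HB.pack (fglift f) F.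
move=> a D; rewrite -[fglift f]/(G : _ -> _).
have -> : a *: D = \sum_(b <- dom D) << a * coeff b D *g b >> by [].
rewrite raddf_sum -[D in RHS]freeg_sumE raddf_sum /= scaler_sumr.
by apply: eq_bigr => b _; rewrite !liftU scalerA.
Qed.

(** A projective module is a retract of the free module on its own elements,
    where regularity can be checked one coordinate at a time. *)
Lemma regular_projective (P : lmodType R) k :
  projective_module P -> regular k (@whole R^o) -> regular k (@whole P).
Proof.
move=> projP regR l z lk _ [c [_ xz]].
pose FA := GRing.isAdditive.Build {freeg P / R} P (fglift id) (lift_is_additive id).
pose FS := GRing.isScalable.Build R {freeg P / R} P *:%R (fglift id)
  (@fglift_is_scalable P P id).
pose g : {linear {freeg P / R} -> P} := HB.pack (fglift id : {freeg P / R} -> P) FA FS.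
have [b|h gh] := projP _ _ g idfun.
  by exists << b >>; rewrite /= liftU scale1r.
have hz b : exists r : nat -> R, coeff b (h z) = \sum_(i < l) x i * r i.
  have [|r [_ rE]] := regR l (coeff b (h z)) lk I; last by exists r.
  exists (fun i => coeff b (h (c i))); split=> //.
  transitivity (coeff b (h (x l *: z))); first by rewrite linearZ coeffZ.
  rewrite xz !raddf_sum /=.
  by apply: eq_bigr => i _; rewrite linearZ coeffZ.
have {hz} [r rE] := choice hz.
exists (fun i => \sum_(b <- dom (h z)) r b i *: b); split=> //.
rewrite -[LHS]/(idfun z) -gh -[h z in LHS]freeg_sumE raddf_sum /=.
under [RHS]eq_bigr => i _ do rewrite scaler_sumr.
rewrite exchange_big; apply: eq_bigr => b _; rewrite liftU rE scaler_suml.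
by apply: eq_bigr => i _; rewrite scalerA.
Qed.

(** If the resolution had length [e < n], the syzygy [Z_(e+1)] would vanish,
    yet [socle_syzygy], iterated from [s], gives a nonzero element of it. *)
Theorem pd_ge_regular (M : lmodType R) n (s : M) :
  regular n (@whole R^o) -> s <> 0 -> (forall j, (j < n)%N -> x j *: s = 0) ->
  pd_ge M n.
Proof.
move=> regR s0 xs e [P [d [aug [[projP surj exA exd] Pe0]]]].
have regP i : regular n (@whole (P i)) by exact: regular_projective.
have regPk k i : (k <= n)%N -> regular k (@whole (P i)).
  by move=> kn l z lk; apply: regP; exact: leq_trans kn.
have kaug : kernel aug = image (d 0).
  by apply/funext => z; apply/propext; exact: exA.
have kd i : kernel (d i) = image (d i.+1).
  by apply/funext => z; apply/propext; exact: exd.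
(* The syzygy [Z_(k+1)] is the image of [d k]; the first one is the kernel of
   the augmentation. *)
have step k : (k < n)%N -> regular k.+1 (image (d k)) /\
    exists w, socle_elt n k.+1 (image (d k)) w.
  elim: k => [|k IHk] kn.
    have reg0 : regular 0 (image aug) by [].
    rewrite -kaug; split; first by apply: regular_kernel => //; exact: regPk.
    apply: (@socle_syzygy _ _ _ _ _ s) => //; first exact: regPk.
    split=> [|[c [_]]|j jn]; first exact: surj.
      by rewrite big_ord0.
    by exists (fun=> 0); split=> [i|]; [exists 0; exact: raddf0 | rewrite big_ord0 xs].
  have [regk [w sw]] := IHk (ltnW kn); rewrite -kd; split.
    by apply: regular_kernel => //; exact: regPk.
  by apply: (@socle_syzygy _ _ _ _ _ w) => //; exact: regPk.
rewrite leqNgt; apply/negP => en.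
have [_ [w [[y yw] wN _]]] := step e en; apply: wN.
exists (fun=> 0); split=> [i|]; first by exists 0; exact: raddf0.
by rewrite -yw (Pe0 _ (ltnSn e) y) raddf0 big1 // => i _; rewrite scaler0.
Qed.
End RegularSequence.

Lemma quot_pi_eq0 (R : comNzRingType) l (f : 'I_l -> R) a :
  (quot_pi f a == 0) = (a \in ideal_gen f).
Proof.
have <- : quot_pi f 0 = 0 by apply: (addrI (quot_pi f 0)); rewrite -quot_piD !addr0.
by rewrite quot_pi_eq subr0.
Qed.

(** * Ideals of variables and monomials *)

(** A polynomial is in an ideal generated by variables exactly when each of its
    monomials is divisible by one of them, and multiplying by another variable
    does not change this. *)
Lemma regular_variables (K : fieldType) N (v : nat -> 'I_N) n :
  (forall i l, (i < l)%N -> (l < n)%N -> v i != v l) ->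
  regular (fun i => 'X_(v i)) n (@whole {mpoly K[N]} {mpoly K[N]}^o).
Proof.
move=> v_inj l z ln _ [c [_ xz]].
rewrite [z]mpolyE big_seq; apply: (big_ind (ideal_mul _ l _)).
- by exists (fun=> 0); split=> //; rewrite big1 // => i _; rewrite scaler0.
- by move=> a b; apply: ideal_mulD.
move=> m mz.
have [i vi] : exists i : 'I_l, m (v i) != 0%N.
  have: (m + U_(v l))%MM \in msupp (z * 'X_(v l)).
    by rewrite mcoeff_msupp addmC mcoeffMX -mcoeff_msupp.
  have -> : z * 'X_(v l) = \sum_(i < l) 'X_(v i) * c i by rewrite mulrC.
  move/msupp_sum_le/flattenP => [? /mapP[i _ ->]] /msuppM_le/allpairsP.
  case=> -[m1 m2] /= [+ _ E]; rewrite msuppX inE => /eqP m1E; exists i.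
  move: (congr1 (fun a : 'X_{1..N} => a (v i)) E).
  rewrite m1E !mnmDE !mnm1E eqxx eq_sym (negbTE (v_inj _ _ (ltn_ord i) ln)).
  by rewrite addn0 => ->.
have -> : z@_m *: 'X_[m] = 'X_(v i) *: (z@_m *: 'X_[m - U_(v i)] : {mpoly K[N]}^o).
  by rewrite -[RHS]/(_ * _) -scalerAr -mpolyXD addmC submK // lep1mP.
exact: (@ideal_mul_term _ (fun i => 'X_(v i))).
Qed.

Section Monomials.
Variables (K : fieldType) (N : nat).
Implicit Types (p q : {mpoly K[N]}) (k m : 'X_{1..N}).

(** No monomial of [q] divides ['X_[k]].  For fixed [k] these polynomials form
    the largest monomial ideal that does not contain ['X_[k]]. *)
Definition outside k q := forall m, m \in msupp q -> ~~ (m <= k)%MM.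

Lemma outside_sum k (T : finType) (F : T -> {mpoly K[N]}) :
  (forall t, outside k (F t)) -> outside k (\sum_t F t).
Proof.
by move=> Fk m /msupp_sum_le/flattenP[? /mapP[t _ ->]]; exact: Fk.
Qed.

Lemma outside_mull k p q : outside k q -> outside k (p * q).
Proof.
move=> qk m /msuppM_le/allpairsP[[m1 m2] /= [_ m2q ->]].
by apply: contra (qk _ m2q); apply: lepm_trans; exact: lem_addl.
Qed.

Lemma outside_var k i e : (k i < e)%N -> outside k ('X_i ^+ e).
Proof.
move=> ke m; rewrite mpolyXn msuppX inE => /eqP ->.
apply: contraL ke => /mnm_lepP/(_ i).
by rewrite mulmnE mnm1E eqxx mul1n -leqNgt.
Qed.

Lemma outside_ideal_gen k l (f : 'I_l -> {mpoly K[N]}) q :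
  (forall i, outside k (f i)) -> q \in ideal_gen f -> outside k q.
Proof.
move=> fk /ideal_genP[c ->]; apply: outside_sum => i.
by apply: outside_mull.
Qed.

Lemma monomial_not_outside k : ~ outside k ('X_[k] : {mpoly K[N]}).
Proof. by move/(_ k); rewrite msuppX inE eqxx lepm_refl; move=> /(_ isT). Qed.
End Monomials.

(** * The tower of forms *)

(** Multiplying the sum by [u ^+ (D - e t) * v ^+ (D - (m - e t))] gives
    [u ^+ D * v ^+ D * h t] at the index [t], while at any other index one of
    the two exponents exceeds [D]. *)
Lemma ideal_gen_coeff (R : comNzRingType) l (f : 'I_l -> R) (T : finType)
    (e : T -> nat) (h : T -> R) m D c u v :
  injective e -> (forall t, e t <= m)%N -> (m <= D)%N ->
  c * u ^+ D.+1 \in ideal_gen f -> c * v ^+ D.+1 \in ideal_gen f ->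
  c * (\sum_t u ^+ e t * v ^+ (m - e t) * h t) \in ideal_gen f ->
  forall t, c * (u ^+ D * v ^+ D) * h t \in ideal_gen f.
Proof.
move=> e_inj em mD cu cv csum t.
have high w i a : c * w ^+ D.+1 \in ideal_gen f -> (D < i)%N ->
    c * (w ^+ i * a) \in ideal_gen f.
  move=> cw Di; rewrite -(subnK Di) exprD.
  have -> b : c * (b * w ^+ D.+1 * a) = b * a * (c * w ^+ D.+1).
    by rewrite [c * _]mulrC -!mulrA; congr (_ * _); rewrite mulrCA [c * _]mulrC.
  exact: ideal_genMl.
pose F s := u ^+ (D - e t + e s) * v ^+ (D - (m - e t) + (m - e s)) * h s.
have FE : u ^+ (D - e t) * v ^+ (D - (m - e t)) *
    (c * (\sum_s u ^+ e s * v ^+ (m - e s) * h s)) = c * F t + \sum_(s | s != t) c * F s.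
  transitivity (c * \sum_s F s); last by rewrite (bigD1 t) //= mulrDr mulr_sumr.
  rewrite mulrCA; congr (_ * _); rewrite mulr_sumr; apply: eq_bigr => s _.
  rewrite /F !exprD !mulrA.
  by congr (_ * _ * _); rewrite -!mulrA; congr (_ * _); rewrite mulrC.
have Ft : c * F t = c * (u ^+ D * v ^+ D) * h t.
  rewrite /F !subnK ?mulrA //; last exact: leq_trans (em t) mD.
  exact: leq_trans (leq_subr _ _) mD.
rewrite -Ft -[c * F t](addrK (\sum_(s | s != t) c * F s)) -FE.
apply: rpredB; first exact: ideal_genMl.
apply: rpred_sum => s st; rewrite /F -mulrA.
have [lt_ts|lt_st|/e_inj est] := ltngtP (e t) (e s).
- apply: high => //; move: (em t) (em s) mD lt_ts; lia.
- by rewrite [_ ^+ _ * (_ * _)]mulrCA; apply: high => //;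
    move: (em t) (em s) mD lt_st; lia.
- by rewrite est eqxx in st.
Qed.

Section Construction.
Variables (K : fieldType) (p N : nat).
Variables (x : nat -> bool -> 'I_N) (y : seq 'I_p -> 'I_N).

(** The degree at a level with [r] further levels below it: each level uses up
    [p + 1], and the variables at the bottom have degree 1. *)
Definition level_deg r := (r * p.+1).+1.

(** A sum at one level has [p + 2] terms: the two extreme exponents carry the
    powers of the next two variables, the [p] others a smaller tower. *)
Definition branch_exp (t : bool + 'I_p) : nat :=
  match t with inl b => if b then p.+1 else 0%N | inr a => a.+1 end.

(** [x r true] and [x r false] are the variables [u], [v] of level [r]; [w]
    lists the branches taken from the top, the last one first, and selects the
    variable [y w] at the bottom. *)
Fixpoint tower r (w : seq 'I_p) : {mpoly K[N]} :=
  if r is r'.+1 then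
    \sum_t 'X_(x r true) ^+ branch_exp t
           * 'X_(x r false) ^+ (p.+1 - branch_exp t)
           * match t with
             | inl b => 'X_(x r' b) ^+ level_deg r'
             | inr a => tower r' (a :: w)
             end
  else 'X_(y w).

Definition tower_gens n (i : 'I_3) : {mpoly K[N]} :=
  if i == 0 then 'X_(x n true) ^+ level_deg n
  else if i == 1 then 'X_(x n false) ^+ level_deg n
  else tower n [::].

Lemma branch_exp_le t : (branch_exp t <= p.+1)%N.
Proof. by case: t => [[]|a] //=; rewrite ltnS ltnW. Qed.

Lemma branch_exp_inj : injective branch_exp.
Proof.
move=> [[]|a] [[]|b] //= E; try by have := ltn_ord a; lia.
  by have := ltn_ord b; lia.
by congr inr; apply/val_inj/succn_inj.
Qed.

Lemma homog_var (i : 'I_N) e : ('X_i ^+ e : {mpoly K[N]}) \is e.-homog.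
Proof. by rewrite mpolyXn dhomogX /= mdegMn mdeg1 mul1n. Qed.

Lemma tower_homog r w : tower r w \is (level_deg r).-homog.
Proof.
elim: r w => [|r IHr] w; first by rewrite dhomogX /= mdeg1.
apply: rpred_sum => t _ /=.
have -> : level_deg r.+1 = (branch_exp t + (p.+1 - branch_exp t) + level_deg r)%N.
  by rewrite subnKC ?branch_exp_le // /level_deg mulSn addnS.
apply: dhomogM; first by apply: dhomogM; exact: homog_var.
by case: t => [b|a]; [exact: homog_var | exact: IHr].
Qed.

Lemma tower_gens_homog n i : tower_gens n i \is (level_deg n).-homog.
Proof.
by rewrite /tower_gens; do 2![case: ifP => _; first exact: homog_var];
  exact: tower_homog.
Qed.

Lemma tower_outside (k : 'X_{1..N}) r w :
  (forall s, k (y s) = 0%N) ->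
  (forall j b, (j < r)%N -> (k (x j b) < level_deg j)%N) ->
  outside k (tower r w).
Proof.
move=> ky; elim: r w => [|r IHr] w kx /=.
  by apply: (@outside_var _ _ _ _ 1); rewrite ky.
apply: outside_sum => t; apply: outside_mull; case: t => [b|a].
  exact/outside_var/kx.
by apply: IHr => j b jr; apply: kx; exact: ltnW.
Qed.

(** The factor of level 0 is 1, as [level_deg 0 = 1]; it is kept so that the
    product ranges over all the level variables. *)
Definition socle_poly r : {mpoly K[N]} :=
  \prod_(j < r.+1) ('X_(x j true) ^+ (level_deg j).-1
                    * 'X_(x j false) ^+ (level_deg j).-1).

(** Descend one level at a time: [ideal_gen_coeff] with the factor
    [(u v)^(D-1)], where [D = level_deg r.+1], passes from the powers of [u],
    [v] and the towers at level [r+1] to those at level [r]. *)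
Lemma socle_poly_leaf l (f : 'I_l -> {mpoly K[N]}) r c d :
  (forall b, c * 'X_(x r b) ^+ level_deg r \in ideal_gen f) ->
  (forall w, size w = d -> c * tower r w \in ideal_gen f) ->
  forall w, size w = (d + r)%N -> c * socle_poly r * 'X_(y w) \in ideal_gen f.
Proof.
elim: r c d => [|r IHr] c d cx cw w sw.
  by rewrite /socle_poly big_ord_recr big_ord0 /= !mulr1; apply: cw; rewrite sw addn0.
rewrite /socle_poly big_ord_recr /= [X in c * X]mulrC mulrA.
pose child u t := match t with
  | inl b => 'X_(x r b) ^+ level_deg r
  | inr a => tower r (a :: u)
  end.
have step u t : size u = d ->
    c * ('X_(x r.+1 true) ^+ (level_deg r.+1).-1
         * 'X_(x r.+1 false) ^+ (level_deg r.+1).-1) * child u t \in ideal_gen f.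
  move=> su; apply: (ideal_gen_coeff (h := child u) branch_exp_inj branch_exp_le).
  - by rewrite /level_deg mulSn leq_addr.
  - exact: cx.
  - exact: cx.
  - exact: cw.
apply: (IHr _ d.+1) => [b|[|a u] //= [su]|]; last by rewrite sw addSnnS.
  have [u su] : exists u : seq 'I_p, size u = d.
    by exists (take d w); rewrite size_takel // sw leq_addr.
  exact: (step u (inl b)).
exact: (step u (inr a)).
Qed.

End Construction.

(** * The ideal of the tower *)

Section TowerVariables.
Variables (K : fieldType) (p n : nat) (hp : (0 < p)%N).

Definition tower_var := ('I_n.+1 * bool + n.-tuple 'I_p)%type.

Definition level_var j b : 'I_#|{: tower_var}| := enum_rank (inl (inord j, b)).

(** The default tuple only serves the words whose length is not [n], which
    never occur in the tower of height [n]. *)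
Definition leaf_var (w : seq 'I_p) : 'I_#|{: tower_var}| :=
  enum_rank (inr (insubd [tuple of nseq n (Ordinal hp)] w)).

Lemma level_var_inj j b j' b' :
  (j <= n)%N -> (j' <= n)%N ->
  (level_var j b == level_var j' b') = (j == j') && (b == b').
Proof.
move=> jn j'n; rewrite (inj_eq enum_rank_inj).
by rewrite /eq_op /= /eq_op /= -val_eqE /= !inordK.
Qed.

Lemma leaf_level_var w j b : leaf_var w != level_var j b.
Proof. by rewrite (inj_eq enum_rank_inj). Qed.

Lemma leaf_var_inj (s t : n.-tuple 'I_p) : (leaf_var s == leaf_var t) = (s == t).
Proof. by rewrite (inj_eq enum_rank_inj) /eq_op /= !valKd. Qed.

Definition socle_exp : 'X_{1..#|{: tower_var}|} :=
  [multinom if enum_val i is inl (j, _) then (level_deg p j).-1 else 0%N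
     | i < #|{: tower_var}|].

Lemma socle_exp_level j b :
  (j <= n)%N -> socle_exp (level_var j b) = (level_deg p j).-1.
Proof. by move=> jn; rewrite mnmE enum_rankK inordK. Qed.

Lemma socle_exp_leaf w : socle_exp (leaf_var w) = 0%N.
Proof. by rewrite mnmE enum_rankK. Qed.

Lemma socle_monomial : socle_poly K p level_var n = 'X_[socle_exp].
Proof.
rewrite mpolyXE_id (reindex (@enum_rank tower_var)); last exact/onW_bij/enum_rank_bij.
rewrite big_sumType /= [X in _ * X]big1 ?mulr1 => [|t _]; last first.
  by rewrite mnmE enum_rankK expr0.
transitivity (\prod_(j < n.+1) \prod_b 'X_(level_var j b) ^+ (level_deg p j).-1
    : {mpoly K[#|{: tower_var}|]}).
  by apply: eq_bigr => j _; rewrite big_bool.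
rewrite pair_bigA; apply: eq_bigr => -[j b] _ /=.
by rewrite mnmE enum_rankK /level_var inord_val.
Qed.

Let f := tower_gens K level_var leaf_var n.

Lemma leaf_socle w :
  size w = n -> 'X_[socle_exp] * 'X_(leaf_var w) \in ideal_gen f.
Proof.
have gen i : f i \in ideal_gen f.
  apply/ideal_genP; exists (fun j => (j == i)%:R).
  rewrite (bigD1 i) //= eqxx mul1r big1 ?addr0 // => j /negbTE ->.
  by rewrite mul0r.
rewrite -socle_monomial => wn; rewrite -[socle_poly _ _ _ _]mul1r.
apply: (@socle_poly_leaf _ _ _ _ leaf_var _ _ _ _ 0) => // [b|u /size0nil ->].
  by rewrite mul1r; case: b; [exact: (gen 0) | exact: (gen 1)].
by rewrite mul1r; exact: (gen (@Ordinal 3 2 isT)).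
Qed.

(** Every factor of [s] has exponent one less than the power of the same
    variable that occurs in the generators, and [s] involves no leaf. *)
Lemma socle_notin : 'X_[socle_exp] \notin ideal_gen f.
Proof.
apply/negP => /outside_ideal_gen H; apply: (@monomial_not_outside K _ socle_exp).
apply: H => i; rewrite /f /tower_gens; case: ifP => _; last case: ifP => _.
- by apply: outside_var; rewrite socle_exp_level.
- by apply: outside_var; rewrite socle_exp_level.
apply: tower_outside => [s|j b jn]; first exact: socle_exp_leaf.
by rewrite socle_exp_level // ltnW.
Qed.

Lemma pd_tower : pd_ge (quot_ideal f) (p ^ n)%N.
Proof.
pose s := enum {: n.-tuple 'I_p}.
have sz : size s = (p ^ n)%N by rewrite -cardE card_tuple card_ord.
pose t0 := [tuple of nseq n (Ordinal hp)].
pose v i := leaf_var (nth t0 s i).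
apply: (@pd_ge_regular _ (fun i => 'X_(v i)) _ _ (quot_pi f 'X_[socle_exp])).
- apply: regular_variables => i l il ln; rewrite leaf_var_inj.
  by rewrite nth_uniq ?sz ?enum_uniq ?ltn_eqF // (ltn_trans il).
- by move/eqP; rewrite quot_pi_eq0; apply/negP/socle_notin.
move=> j jn; rewrite [LHS]quot_scale_pi; apply/eqP.
rewrite quot_pi_eq0 mulrC.
by apply: leaf_socle; rewrite size_tuple.
Qed.

(** A monomial ideal separates each generator from the other two.  For a power
    of a variable it is the ideal avoiding that power.  The tower is compared
    with [s] times a leaf, which is in the ideal of the three generators but
    not in that of the two powers. *)
Lemma tower_gens_minimal : minimal_generators f.
Proof.
have power_notin (g : 'I_2 -> {mpoly K[_]}) b :
    (forall i, g i = 'X_(level_var n (~~ b)) ^+ level_deg p n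
            \/ g i = tower K level_var leaf_var n [::]) ->
    'X_(level_var n b) ^+ level_deg p n \notin ideal_gen g.
  move=> gE; apply/negP; rewrite mpolyXn => /outside_ideal_gen H.
  apply: (@monomial_not_outside K _ (U_(level_var n b) *+ level_deg p n)).
  apply: H => i; case: (gE i) => ->.
    apply: outside_var; rewrite mulmnE mnm1E level_var_inj // eqxx.
    by case: b {gE}; rewrite mul0n.
  apply: tower_outside => [s|j c jn]; rewrite mulmnE mnm1E.
    by rewrite eq_sym (negbTE (leaf_level_var _ _ _)).
  by rewrite level_var_inj ?(ltnW jn) // gtn_eqF.
case=> [[|[|[|//]]] lt3].
- apply: (power_notin _ true) => -[[|[|//]] lt2]; [left|right] => //.
- apply: (power_notin _ false) => -[[|[|//]] lt2]; [left|right] => //.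
set i2 := Ordinal lt3.
apply/negP => tower_in.
pose w := [tuple of nseq n (Ordinal hp)].
pose k := (socle_exp + U_(leaf_var w))%MM.
apply: (@monomial_not_outside K _ k).
have powers_out i : outside k (f (lift i2 i)).
  have xk b : outside k ('X_(level_var n b) ^+ level_deg p n : {mpoly K[_]}).
    apply: outside_var; rewrite mnmDE mnm1E (negbTE (leaf_level_var _ _ _)).
    by rewrite addn0 socle_exp_level.
  by case: i => -[|[|//]] lt2; exact: xk.
have k_in : 'X_[k] \in ideal_gen f by rewrite mpolyXD; apply/leaf_socle/size_tuple.
apply: (outside_ideal_gen _ k_in) => i.
have [j ->|->] := unliftP i2 i; first exact: powers_out.
exact: outside_ideal_gen powers_out tower_in.
Qed.
End TowerVariables.

Theorem corollary3p5 (K : fieldType) (p : nat) (hp : (0 < p)%N) :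
  exists (n : nat) (f : 'I_3 -> {mpoly K[n]}),
    [/\ forall i, f i \is (p ^ 2)%N.-homog,
        minimal_generators f
      & pd_ge (quot_ideal f) (p ^ (p - 1))%N].
Proof.
have deg : level_deg p p.-1 = (p ^ 2)%N by case: p hp => // q _; rewrite /level_deg; nia.
exists #|{: tower_var p p.-1}|.
exists (tower_gens K (@level_var p p.-1) (@leaf_var p p.-1 hp) p.-1); split.
- by move=> i; rewrite -deg; exact: tower_gens_homog.
- exact: tower_gens_minimal.
by rewrite subn1; exact: pd_tower.
Qed.
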